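(* Let $N \geq 2$ and $1 \leq k \leq N-1$. The probability that a $321$-avoiding permutation of length $N$ (chosen uniformly at random among all $321$-avoiding permutations of length $N$) is $k$-winnable is $$\frac{1}{C_N} \sum_{i=1}^{N-k} \binom{(k-1)+(N-i)}{k-1} \frac{(N-k-i+2)}{(N-i)+1}\,(N-k-i+1).$$
   Context: $C_n = \frac{1}{n+1}\binom{2n}{n}$ denotes the $n$th Catalan number. A permutation of length $N$ is an arrangement $p_1 p_2 \cdots p_N$ of the values $1,2,\ldots,N$. It is $321$-avoiding if there do not exist $i<j<l$ with $p_i>p_j>p_l$. A left-to-right maximum of $p$ is an entry $p_j$ with $p_j > p_i$ for all $i<j$. A permutation $p$ of length $N$ is $k$-winnable if rejecting $p_1,\ldots,p_k$ and then accepting the next left-to-right maximum of $p$ in a position $>k$ selects the value $N$; that is, $N$ lies in a position $>k$ and is the first left-to-right maximum among the positions $k+1,k+2,\ldots,N$. *)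

(* Defs.v *)
From mathcomp Require Import all_boot all_order all_algebra all_fingroup.

Set Implicit Arguments.
Unset Strict Implicit.
Unset Printing Implicit Defensive.

Import Order.TTheory GRing.Theory Num.Theory.
Local Open Scope ring_scope.

Definition catalan (n : nat) : rat := n.+1%:R^-1 * 'C(n.*2, n)%:R.

(* A permutation p_1 ... p_N of the values 1, ..., N is encoded as p : 'S_N on
   {0, ..., N-1}: position j.+1 carries the value (p j).+1. *)

Definition avoids321 (N : nat) (p : 'S_N) : bool :=
  ~~ [exists i : 'I_N, [exists j : 'I_N, [exists l : 'I_N,
        [&& (i < j)%N, (j < l)%N, (p j < p i)%N & (p l < p j)%N]]]].

Definition lr_max (N : nat) (p : 'S_N) (j : 'I_N) : bool :=
  [forall i : 'I_N, (i < j)%N ==> (p i < p j)%N].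

Definition first_lr_max_after (N : nat) (p : 'S_N) (k : nat) (j : 'I_N) : bool :=
  [&& (k < j.+1)%N, lr_max p j &
      [forall i : 'I_N, (k < i.+1)%N && lr_max p i ==> (j <= i)%N]].

Definition winnable (N k : nat) (p : 'S_N) : bool :=
  [exists j : 'I_N, first_lr_max_after p k j && ((p j).+1 == N)].

(* The probability that an element of A chosen uniformly at random satisfies E
   (0 when A is empty). *)
Definition uniform_prob (T : finType) (A E : pred T) : rat :=
  #|[set x | A x && E x]|%:R / #|[set x | A x]|%:R.

(* Main.v *)
Require Import Defs.
From mathcomp Require Import all_boot all_order all_algebra all_fingroup.
From mathcomp Require Import zify.
Import Order.TTheory GRing.Theory Num.Theory.
Local Open Scope ring_scope.

(** The proof passes from a 321-avoiding permutation [p] to the sequence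
    [runmax p] of its running maxima, [runmax p j = max (p 0, ..., p j)].

    Such a sequence is nondecreasing and lies on or above the diagonal: it is a
    ballot sequence (a Dyck path).  On 321-avoiding permutations the map is a
    bijection onto all ballot sequences: the entries that are not records
    appear in increasing order, so the records determine everything
    ([runmax_inj]), and every ballot sequence occurs ([ballot_runmax_avoids]).

    Winning is visible on the running maxima: rejecting the first [k] entries
    leaves the maximum [m] of these entries as the threshold, and the next
    record is the overall maximum exactly when, after position [k], the running
    maximum stays at [m] and then jumps directly to the top value
    ([winnable_two_step]).  Such a ballot sequence amounts to its initial
    segment of length [k] together with the place of the jump.  Counting values
    from 1, the diagonal condition leaves [m - k + 1] places for the jump, and
    the number of initial segments ending in [m] is the number of ballot
    sequences of length [k - 1] with values at most [m]
    ([card_two_step]).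

    The latter are counted by the ballot formula, proved by Pascal's rule
    ([card_ballots_below_bin]).  The case of full length gives the Catalan
    number in the denominator, and the substitution [i = N - m] turns the sum
    over thresholds into the one of the theorem. *)

Set Implicit Arguments.
Unset Strict Implicit.
Unset Printing Implicit Defensive.

Local Open Scope nat_scope.

(** * Running maxima *)

Definition runmax (N : nat) (p : 'S_N) : {ffun 'I_N -> 'I_N} :=
  [ffun j : 'I_N => p [arg max_(i > j | i <= j) p i]].

Lemma runmax_attained N (p : 'S_N) (j : 'I_N) :
  exists2 i : 'I_N, i <= j & runmax p j = p i.
Proof. by rewrite ffunE; case: arg_maxnP => // i le_ij _; exists i. Qed.

Lemma runmax_ub N (p : 'S_N) (i j : 'I_N) : i <= j -> p i <= runmax p j.
Proof. by rewrite ffunE; case: arg_maxnP => // l _ ub /ub. Qed.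

Lemma runmax_eq N (p : 'S_N) (j i : 'I_N) :
  i <= j -> (forall l : 'I_N, l <= j -> p l <= p i) -> runmax p j = p i.
Proof.
move=> le_ij ub; apply/val_inj/eqP; rewrite eqn_leq runmax_ub // andbT.
by have [l le_lj ->] := runmax_attained p j; exact: ub.
Qed.

Lemma avoids321P N (p : 'S_N) :
  reflect (forall i j l : 'I_N, i < j -> j < l -> p j < p i -> p l < p j -> False)
          (avoids321 p).
Proof.
apply: (iffP negP) => [av i j l ij jl pji plj | av].
  by apply: av; apply/existsP; exists i; apply/existsP; exists j; apply/existsP;
     exists l; apply/and4P.
by move=> /existsP[i /existsP[j /existsP[l /and4P[]]]]; exact: av.
Qed.

(** * Running maxima determine a 321-avoiding permutation *)

(** Suppose [p] and [q] first differ at [j], with [p j < q j].  Then [p j] lies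
    strictly below the common running maximum, which is therefore attained
    earlier, at [i < j], where [p] and [q] agree; and the value [p j] occurs in
    [q] after [j].  Hence [q i > q j > p j] is a 321 pattern of [q]. *)
Lemma avoids321_eq_runmax_le N (p q : 'S_N) (j : 'I_N) :
  avoids321 q -> runmax p = runmax q ->
  (forall i : 'I_N, i < j -> p i = q i) -> q j <= p j.
Proof.
move=> /avoids321P avq eH eqlt; rewrite leqNgt; apply/negP => ltpq.
have [i le_ij Hi] := runmax_attained p j.
have := runmax_ub q (leqnn j); rewrite -eH Hi => leqp.
have ltij : i < j.
  rewrite ltn_neqAle le_ij andbT; apply/eqP => /val_inj eij.
  by move: leqp; rewrite eij leqNgt ltpq.
have ltq : q j < q i.
  rewrite ltn_neqAle -{2}(eqlt _ ltij) leqp andbT; apply/eqP => /val_inj/perm_inj eij.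
  by move: ltij; rewrite eij ltnn.
have ltjl : j < (q^-1)%g (p j).
  rewrite ltnNge leq_eqVlt; apply/negP => /orP[/eqP/val_inj e | lt_lj].
    by move: ltpq; rewrite -{2}e permKV ltnn.
  have := eqlt _ lt_lj; rewrite permKV => /perm_inj e.
  by move: lt_lj; rewrite e ltnn.
by apply: (avq i j _ ltij ltjl ltq); rewrite permKV.
Qed.

Lemma runmax_inj N : {in @avoids321 N &, injective (@runmax N)}.
Proof.
move=> p q avp avq eH; apply/permP.
suff eq_lt n (j : 'I_N) : j < n -> p j = q j by move=> j; exact: (eq_lt j.+1).
elim: n j => // n IHn j; rewrite ltnS => le_jn.
have eqlt (i : 'I_N) : i < j -> p i = q i.
  by move=> lt_ij; apply: IHn; exact: leq_trans lt_ij le_jn.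
apply/val_inj/eqP; rewrite eqn_leq (avoids321_eq_runmax_le avq eH eqlt) andbT.
by apply: (avoids321_eq_runmax_le avp) => // i /eqlt.
Qed.

(** * Every ballot sequence is a sequence of running maxima *)

Definition ballot (N n : nat) (g : {ffun 'I_n -> 'I_N}) : bool :=
  [forall i : 'I_n, forall j : 'I_n, (i <= j) ==> (g i <= g j)]
  && [forall i : 'I_n, i <= g i].

Lemma ballotP N n (g : {ffun 'I_n -> 'I_N}) :
  reflect ((forall i j : 'I_n, i <= j -> g i <= g j)
           /\ (forall i : 'I_n, i <= g i))
          (ballot g).
Proof.
apply: (iffP andP) => [[/'forall_forallP mono /forallP diag] | [mono diag]].
  by split=> // i j; apply/implyP.
by split; [apply/'forall_forallP => i j; apply/implyP; apply: mono | apply/forallP].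
Qed.

(** The diagonal condition is the pigeonhole principle: the [j.+1] distinct
    values [p 0, ..., p j] are all at most [runmax p j]. *)
Lemma runmax_ballot N (p : 'S_N) : ballot (runmax p).
Proof.
apply/ballotP; split=> [i j le_ij | j].
  have [l le_li ->] := runmax_attained p i.
  by apply: runmax_ub; exact: leq_trans le_ij.
have inj : injective (fun i : 'I_j.+1 =>
    (inord (p (widen_ord (ltn_ord j) i)) : 'I_(runmax p j).+1)).
  have lt_pH (x : 'I_j.+1) : p (widen_ord (ltn_ord j) x) < (runmax p j).+1.
    by rewrite ltnS runmax_ub //= -ltnS.
  move=> x y /(congr1 val); rewrite /= !inordK // => /val_inj/perm_inj/(congr1 val) e.
  exact: val_inj.
by have := leq_card _ inj; rewrite !card_ord.
Qed.

(** Start from the identity, which lies below [h], and correct the running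
    maximum one position after another: if it is too small at [j], the value
    [h j] occurs to the right of [j], and exchanging it with the value at [j]
    keeps the permutation below [h] without touching the positions before
    [j]. *)
Lemma ballot_runmax N (h : {ffun 'I_N -> 'I_N}) :
  ballot h -> exists p : 'S_N, runmax p = h.
Proof.
move=> /ballotP[mono diag].
suff [p [_ agree]] : exists p : 'S_N,
    (forall j, p j <= h j) /\ (forall j : 'I_N, j < N -> runmax p j = h j).
  by exists p; apply/ffunP => j; exact: agree.
suff main n : n <= N -> exists p : 'S_N,
    (forall j, p j <= h j) /\ (forall j : 'I_N, j < n -> runmax p j = h j).
  exact: (main N).
elim: n => [_ | n IHn lt_nN].
  by exists 1%g; split=> // j; rewrite perm1.
have [p [le_ph agree]] := IHn (ltnW lt_nN).
pose j := Ordinal lt_nN.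
have le_Hh : runmax p j <= h j.
  have [i le_ij ->] := runmax_attained p j.
  exact: leq_trans (le_ph i) (mono _ _ le_ij).
have [eqHh | neHh] := eqVneq (runmax p j) (h j).
  exists p; split=> // i; rewrite ltnS leq_eqVlt => /orP[/eqP e | /agree //].
  by have -> : i = j by exact: val_inj.
have ltHh : runmax p j < h j by rewrite ltn_neqAle neHh le_Hh.
pose l := (p^-1)%g (h j).
have pl : p l = h j by rewrite permKV.
have lt_jl : j < l.
  by rewrite ltnNge; apply/negP => /(runmax_ub p); rewrite pl leqNgt ltHh.
pose q := (tperm j l * p)%g.
have qj : q j = h j by rewrite permM tpermL.
have ql : q l = p j by rewrite permM tpermR.
have qD i : i != j -> i != l -> q i = p i.
  by move=> ij il; rewrite permM tpermD // eq_sym.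
have q_lt (i : 'I_N) : i < n -> q i = p i.
  move=> lt_in; apply: qD; apply/eqP => e; move: lt_in; rewrite e /=.
    by rewrite ltnn.
  by rewrite ltnNge ltnW.
exists q; split=> i.
  have [-> | ij] := eqVneq i j; first by rewrite qj.
  have [-> | il] := eqVneq i l; last by rewrite qD.
  by rewrite ql (leq_trans (le_ph j)) ?mono // ltnW.
rewrite ltnS leq_eqVlt => /orP[/eqP e | lt_in].
  have -> : i = j by exact: val_inj.
  rewrite -qj; apply: runmax_eq => // x; rewrite leq_eqVlt => /orP[/eqP/val_inj -> // | lt_xn].
  by rewrite q_lt // qj (leq_trans _ le_Hh) // runmax_ub // ltnW.
have [x le_xi Hx] := runmax_attained p i.
rewrite -agree // Hx -q_lt ?(leq_ltn_trans le_xi) //.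
apply: runmax_eq => // y le_yi.
by rewrite !q_lt ?(leq_ltn_trans _ lt_in) // -Hx runmax_ub.
Qed.

(** Exchanging the two lower entries of a 321 pattern does not change the
    running maxima, as both entries stay hidden behind the larger entry [p i].
    By [sum_swap_lt] it increases the sum of the [i * p i], so that a
    permutation with prescribed running maxima that maximises this sum avoids
    321. *)
Lemma runmax_swap N (p : 'S_N) (i j l : 'I_N) :
  i < j -> j < l -> p j < p i -> p l < p j ->
  runmax (tperm j l * p)%g = runmax p.
Proof.
move=> lt_ij lt_jl ltji ltlj; apply/ffunP => x.
have [y le_yx Hy] := runmax_attained p x.
have ub (z : 'I_N) : z <= x -> p z <= p y.
  by move=> le_zx; rewrite -Hy runmax_ub.
have below (z : 'I_N) : i < z -> z <= x -> p i <= p y.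
  by move=> lt_iz le_zx; apply: ub; exact/ltnW/(leq_trans lt_iz).
have lt_il := ltn_trans lt_ij lt_jl; have ltli := ltn_trans ltlj ltji.
have ne_j : j != y.
  by apply: contraTneq ltji => e; rewrite -leqNgt e (below j) // e.
have ne_l : l != y.
  by apply: contraTneq ltli => e; rewrite -leqNgt e (below l) // e.
have qy : (tperm j l * p)%g y = p y by rewrite permM tpermD.
rewrite Hy -qy; apply: runmax_eq => // z le_zx; rewrite qy permM.
case: tpermP => [ezj | ezl | _ _]; last exact: ub.
  by apply: leq_trans (ltnW ltli) (below j lt_ij _); rewrite -ezj.
by apply: leq_trans (ltnW ltji) (below l lt_il _); rewrite -ezl.
Qed.

Lemma sum_swap_lt N (p : 'S_N) (j l : 'I_N) :
  j < l -> p l < p j ->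
  \sum_(i < N) i * p i < \sum_(i < N) i * (tperm j l * p)%g i.
Proof.
move=> lt_jl ltlj; have ne : l != j by rewrite -val_eqE /= gtn_eqF.
have split_jl (F : 'I_N -> nat) :
    \sum_(i < N) F i = F j + (F l + \sum_(i < N | (i != j) && (i != l)) F i).
  by rewrite (bigD1 j) //= (bigD1 l).
rewrite !split_jl !permM tpermL tpermR !addnA.
rewrite (eq_bigr (fun i : 'I_N => i * (tperm j l * p)%g i)) => [|i /andP[ij il]].
  rewrite ltn_add2r; move: lt_jl ltlj.
  move: (nat_of_ord j) (nat_of_ord l) (nat_of_ord (p j)) (nat_of_ord (p l)).
  by move=> a b c d /subnKC <- /subnKC <-; lia.
by rewrite permM tpermD // eq_sym.
Qed.

Lemma ballot_runmax_avoids N (h : {ffun 'I_N -> 'I_N}) :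
  ballot h -> exists2 p : 'S_N, avoids321 p & runmax p = h.
Proof.
move=> /ballot_runmax[p0 /eqP Hp0].
case: (@arg_maxnP _ p0 (fun p => runmax p == h) (fun p : 'S_N => \sum_(i < N) i * p i) Hp0)
  => p /eqP Hp pmax.
exists p => //; apply/avoids321P => i j l lt_ij lt_jl ltji ltlj.
have := pmax (tperm j l * p)%g; rewrite (runmax_swap lt_ij) // Hp eqxx => /(_ isT).
by rewrite /= leqNgt sum_swap_lt.
Qed.

(** The running-maximum bijection turns a count of 321-avoiding permutations
    into one of ballot sequences, for any event that the running maxima
    decide. *)
Lemma card_avoids321_runmax N (E : pred 'S_N) (F : pred {ffun 'I_N -> 'I_N}) :
  (forall p, E p = F (runmax p)) ->
  #|[set p | avoids321 p && E p]| = #|[set h | ballot h && F h]|.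
Proof.
move=> EF; rewrite -(card_in_imset (f := @runmax N)); last first.
  by move=> p q; rewrite !inE => /andP[avp _] /andP[avq _]; exact: runmax_inj.
apply: eq_card => h; rewrite inE; apply/imsetP/andP => [[p + ->] | [bh Fh]].
  by rewrite inE EF runmax_ballot => /andP[].
have [p avp Hp] := ballot_runmax_avoids bh.
by exists p; rewrite // inE avp EF Hp.
Qed.

(** * Winning in terms of running maxima *)

Lemma lr_maxE N (p : 'S_N) (j : 'I_N) : lr_max p j = (runmax p j == p j).
Proof.
apply/forallP/eqP => [lr | e i].
  apply: runmax_eq => // l; rewrite leq_eqVlt => /orP[/eqP/val_inj -> // | lt_lj].
  exact/ltnW/(implyP (lr l)).
apply/implyP => lt_ij; rewrite ltn_neqAle -{2}e runmax_ub ?(ltnW lt_ij) // andbT.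
by apply/eqP => /val_inj/perm_inj e'; rewrite e' ltnn in lt_ij.
Qed.

(** Positions and values count from 0: the last of the [k.+1] rejected entries
    is at position [k], and [h (inord k)] is the threshold that they leave. *)
Definition two_step (n k : nat) (h : {ffun 'I_n.+1 -> 'I_n.+1}) : bool :=
  (h (inord k) < n) &&
  [exists j : 'I_n.+1, [&& k < j, h j == n :> nat &
     [forall i : 'I_n.+1, (k <= i) && (i < j) ==> (h i == h (inord k))]]].

Lemma winnable_two_step n k (p : 'S_n.+1) :
  k < n -> winnable k.+1 p = two_step k (runmax p).
Proof.
move=> lt_kn; have kK : (inord k : 'I_n.+1) = k :> nat.
  by rewrite inordK // ltnS ltnW.
set H := runmax p.
apply/existsP/andP => [[j /andP[/and3P[lt_kj lrj /forallP first] /eqP[pj]]] |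
                       [ltHk /existsP[j /and3P[lt_kj /eqP Hj /forallP flat]]]].
  rewrite ltnS in lt_kj.
  have Hj : H j = p j by apply/eqP; rewrite -lr_maxE.
  split.
    have [i le_ik ->] := runmax_attained p (inord k).
    have := ltn_ord (p i); rewrite ltnS leq_eqVlt => /orP[|//].
    rewrite -[X in _ == X]pj => /eqP/val_inj/perm_inj e.
    by move: le_ik; rewrite kK e leqNgt lt_kj.
  apply/existsP; exists j; rewrite lt_kj Hj pj eqxx /=.
  apply/forallP => i; apply/implyP => /andP[le_ki lt_ij].
  have [l le_li Hl] := runmax_attained p i.
  have ub (x : 'I_n.+1) : x <= i -> p x <= p l.
    by move=> le_xi; rewrite -Hl runmax_ub.
  (* If the running maximum at [i] were attained after [k], it would be
     attained at a record between [k] and [j]. *)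
  have le_lk : l <= k.
    rewrite leqNgt; apply/negP => lt_kl.
    have := first l; rewrite ltnS lt_kl lr_maxE /= implybE (leqNgt j) (leq_ltn_trans le_li) //.
    rewrite orbF (@runmax_eq _ p l l) ?eqxx // => x le_xl.
    by apply: ub; exact: leq_trans le_li.
  rewrite /H Hl; apply/eqP; rewrite (@runmax_eq _ p (inord k) l) ?kK // => x le_xk.
  exact/ub/(leq_trans le_xk).
have [mono _] := ballotP _ (runmax_ballot p).
have ltH (i : 'I_n.+1) : i < j -> H i < n.
  move=> lt_ij; have [le_ki | lt_ik] := leqP k i.
    by have := flat i; rewrite le_ki lt_ij => /eqP ->.
  by apply: leq_ltn_trans ltHk; apply: mono; rewrite kK ltnW.
have [l le_lj Hl] := runmax_attained p j.
have elj : l = j.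
  apply/val_inj/eqP; rewrite eqn_leq le_lj leqNgt /=; apply/negP => /ltH.
  by apply/negP; rewrite -leqNgt -[leqLHS]Hj /H Hl runmax_ub.
rewrite elj in Hl; exists j; rewrite -Hl Hj eqxx andbT; apply/and3P; split=> //.
  by rewrite lr_maxE Hl.
apply/forallP => i; apply/implyP; rewrite ltnS lr_maxE => /andP[lt_ki /eqP Hi].
rewrite leqNgt; apply/negP => lt_ij.
have := flat i; rewrite (ltnW lt_ki) lt_ij /= => /eqP; rewrite /H Hi.
have [x le_xk ->] := runmax_attained p (inord k) => /perm_inj e.
by move: le_xk; rewrite -e kK leqNgt lt_ki.
Qed.

(** * Initial segments and extensions of finite sequences *)

Definition initial (T : Type) n m (le_nm : n <= m) (g : {ffun 'I_m -> T}) :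
  {ffun 'I_n -> T} := [ffun i => g (widen_ord le_nm i)].

Definition extend (T : Type) n m (g : {ffun 'I_n -> T}) (c : nat -> T) :
  {ffun 'I_m -> T} := [ffun i : 'I_m => if insub (i : nat) is Some i' then g i' else c i].

Lemma extend_lt T n m (g : {ffun 'I_n -> T}) c (i : 'I_m) (lt_in : i < n) :
  extend m g c i = g (Ordinal lt_in).
Proof. by rewrite ffunE insubT. Qed.

Lemma extend_ge T n m (g : {ffun 'I_n -> T}) c (i : 'I_m) :
  n <= i -> extend m g c i = c i.
Proof. by move=> le_ni; rewrite ffunE insubN // -leqNgt. Qed.

Lemma initialK T n m (le_nm : n <= m) (g : {ffun 'I_n -> T}) c :
  initial le_nm (extend m g c) = g.
Proof.
apply/ffunP => i; rewrite ffunE extend_lt //= => lt_in.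
by congr (g _); exact: val_inj.
Qed.

Lemma ballot_initial N n m (le_nm : n <= m) (g : {ffun 'I_m -> 'I_N}) :
  ballot g -> ballot (initial le_nm g).
Proof.
move=> /ballotP[mono diag]; apply/ballotP.
by split=> [i j le_ij | i]; rewrite !ffunE ?mono // (diag (widen_ord le_nm i)).
Qed.

Lemma ballot_extend N n m (g : {ffun 'I_n -> 'I_N}) (c : nat -> 'I_N) :
    ballot g -> (forall i j, n <= i -> i <= j -> j < m -> c i <= c j) ->
    (forall (i : 'I_n) j, n <= j -> j < m -> g i <= c j) ->
    (forall i, n <= i -> i < m -> i <= c i) ->
  ballot (extend m g c).
Proof.
move=> /ballotP[mono diag] cmono gc cdiag; apply/ballotP; split=> [i j le_ij | i]; last first.
  have [le_ni | lt_in] := leqP n i; first by rewrite extend_ge ?cdiag.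
  by rewrite extend_lt (diag (Ordinal lt_in)).
have [le_ni | lt_in] := leqP n i.
  by rewrite !extend_ge ?cmono // (leq_trans le_ni).
have [le_nj | lt_jn] := leqP n j.
  by rewrite extend_lt (extend_ge _ _ le_nj) gc.
by rewrite !extend_lt mono.
Qed.

(** * The ballot numbers *)

Definition ballots_below N n M : {set {ffun 'I_n -> 'I_N}} :=
  [set g | ballot g && [forall i, g i < M]].

(** When the last entry is prescribed, it can be dropped: what remains is an
    arbitrary ballot sequence that does not exceed it. *)
Lemma card_ballot_last N n (v : 'I_N) : n <= v ->
  #|[set g : {ffun 'I_n.+1 -> 'I_N} | ballot g && (g ord_max == v)]|
    = #|ballots_below N n v.+1|.
Proof.
move=> le_nv; rewrite -(card_in_imset (f := initial (leqnSn n))); last first.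
  move=> g g'; rewrite !inE => /andP[_ /eqP gv] /andP[_ /eqP g'v] /ffunP e.
  apply/ffunP => i; have [lt_in | le_ni] := ltnP i n.
    have := e (Ordinal lt_in); rewrite !ffunE.
    by have -> : widen_ord (leqnSn n) (Ordinal lt_in) = i by exact: val_inj.
  have -> : i = ord_max by apply/val_inj/eqP; rewrite eqn_leq le_ni -ltnS ltn_ord.
  by rewrite gv.
apply: eq_card => g; rewrite inE; apply/imsetP/andP => [[h + ->] | [bg /forallP gv]].
  rewrite inE => /andP[bh /eqP hv]; split; first exact: ballot_initial.
  have [mono _] := ballotP _ bh.
  by apply/forallP => i; rewrite ffunE ltnS -hv; apply: mono; exact: (ltnW (ltn_ord i)).
exists (extend n.+1 g (fun=> v)); last by rewrite initialK.
rewrite inE extend_ge // eqxx andbT; apply: ballot_extend => // i; last first.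
  by move=> _; rewrite ltnS => /leq_trans; apply.
by move=> j _ _; rewrite -ltnS.
Qed.

(** By monotonicity, a sequence with values below [M.+1] that does not stay
    below [M] ends in [M], and [card_ballot_last] counts those. *)
Lemma card_ballots_belowS N n M : n <= M -> M < N ->
  #|ballots_below N n.+1 M.+1| = #|ballots_below N n.+1 M| + #|ballots_below N n M.+1|.
Proof.
move=> le_nM lt_MN.
rewrite -[M.+1 in RHS]/(Ordinal lt_MN).+1 -card_ballot_last //.
rewrite -(cardsID (ballots_below N n.+1 M)); congr (_ + _); apply: eq_card => g.
  rewrite !inE; case: (ballot g); rewrite //= andb_idl // => /forallP lt.
  by apply/forallP => i; exact/ltnW/lt.
rewrite !inE; have [/ballotP[mono _] | _] := boolP (ballot g) => //=.
apply/andP/eqP => [[/forallPn[i ge] /forallP le] | e].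
  apply/val_inj/eqP; rewrite eqn_leq -ltnS le /=.
  by rewrite -leqNgt in ge; apply: (leq_trans ge); apply: mono; rewrite -ltnS.
split; first by apply/forallPn; exists ord_max; rewrite e ltnn.
apply/forallP => i; rewrite ltnS; have := mono i ord_max; rewrite e; apply.
by rewrite -ltnS.
Qed.

(** The subtracted binomial counts the paths rejected in the reflection
    principle.  Pascal's rule matches the recurrence [card_ballots_belowS]; on
    the boundary [n = M.+1] there is no ballot sequence, and the two binomials
    coincide. *)
Lemma card_ballots_below_bin N n M : n <= M.+1 -> M <= N ->
  #|ballots_below N n M| + 'C(n + M, M.+1) = 'C(n + M, n).
Proof.
elim: n M => [|n IHn] M.
  move=> _ _; rewrite bin_small // addn0 bin0.
  have -> : ballots_below N 0 M = setT.
    apply/setP => g; rewrite !inE; apply/andP.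
    by split; [apply/ballotP; split | apply/forallP] => -[].
  by rewrite cardsT card_ffun !card_ord.
elim: M => [|M IHM].
  rewrite ltnS leqn0 => /eqP -> _; rewrite addn0 binn.
  rewrite (_ : ballots_below N 1 0 = set0) ?cards0 //.
  by apply/setP => g; rewrite !inE; apply/negP => /andP[_ /forallP/(_ ord0)].
rewrite ltnS leq_eqVlt => /orP[/eqP[->] leMN | ltnM ltMN].
  rewrite addSnnS (_ : ballots_below N _ _ = set0) ?cards0 //.
  apply/setP => g; rewrite !inE; apply/negP => /andP[/ballotP[_ diag] /forallP lt].
  by have := lt ord_max; rewrite ltnNge (diag ord_max).
rewrite ltnS in ltnM; rewrite card_ballots_belowS //.
have := IHM ltnM (ltnW ltMN); have := IHn _ (leqW (leqW ltnM)) ltMN.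
by rewrite !addSn !addnS !binS; lia.
Qed.

Lemma card_ballots_below N n M : n <= M.+1 -> M <= N ->
  #|ballots_below N n M| * M.+1 = 'C(n + M, n) * (M.+1 - n).
Proof.
move=> le_nM le_MN; have := card_ballots_below_bin le_nM le_MN.
have := mul_bin_left (n + M) M; rewrite addnK -(bin_sub (leq_addr M n)) addKn.
move: (#|_|) ('C(_, _)) ('C(_, _)) => a b c; nia.
Qed.

Lemma card_interval N a b : b <= N -> #|[set j : 'I_N | a <= j < b]| = b - a.
Proof.
move=> le_bN; rewrite -sum1_card (eq_bigl (fun j : 'I_N => a <= j < b)); last first.
  by move=> j; rewrite inE.
rewrite -(big_mkord (fun j => a <= j < b) (fun=> 1)).
rewrite -[RHS]muln1 -sum_nat_const_nat.
by rewrite (big_nat_widenl a 0) // (big_nat_widen 0 b N).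
Qed.

(** * Counting the winning ballot sequences *)

Definition two_step_of n k (d : {ffun 'I_k.+1 -> 'I_n.+1} * 'I_n.+1) :
    {ffun 'I_n.+1 -> 'I_n.+1} :=
  extend n.+1 d.1 (fun i => if i < d.2 then d.1 ord_max else ord_max).

(** The bound [d.2 <= (d.1 ord_max).+1] is the diagonal condition at the last
    position before the jump. *)
Definition two_step_data n k : {set {ffun 'I_k.+1 -> 'I_n.+1} * 'I_n.+1} :=
  [set d : {ffun 'I_k.+1 -> 'I_n.+1} * 'I_n.+1 |
    [&& ballot d.1, d.1 ord_max < n & k < d.2 <= (d.1 ord_max).+1]].

(** The initial segment is recovered by restriction, and the place of the jump
    as the first position with the top value. *)
Lemma two_step_of_inj n k :
  k < n -> {in two_step_data n k &, injective (@two_step_of n k)}.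
Proof.
move=> lt_kn.
have le_j (g g' : {ffun 'I_k.+1 -> 'I_n.+1}) (j j' : 'I_n.+1) : (g, j) \in two_step_data n k ->
    two_step_of (g, j) = two_step_of (g', j') -> k < j' -> j <= j'.
  rewrite inE /= => /and3P[_ ltg /andP[lt_kj _]] /ffunP/(_ j') e lt_kj'.
  move: e; rewrite !extend_ge //= ltnn; case: (ltnP j' j) => // _ e.
  by rewrite e ltnn in ltg.
move=> [g j] [g' j'] d_in d'_in e.
have eg : g = g' by move/(congr1 (initial (leqW lt_kn))): (e); rewrite !initialK.
have [lt_kj lt_kj'] : k < j /\ k < j'.
  by move: d_in d'_in; rewrite !inE => /and3P[_ _ /andP[-> _]] /and3P[_ _ /andP[-> _]].
rewrite -eg; congr (_, _); apply/val_inj/eqP.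
by rewrite eqn_leq (le_j _ _ _ _ d_in e) // (le_j _ _ _ _ d'_in (esym e)).
Qed.

Lemma two_step_of_image n k : k < n ->
  (@two_step_of n k) @: two_step_data n k = [set h | ballot h && two_step k h].
Proof.
move=> lt_kn; have kK : (inord k : 'I_n.+1) = k :> nat.
  by rewrite inordK // ltnS ltnW.
have widen_max : widen_ord (leqW lt_kn) ord_max = inord k.
  by apply: val_inj; rewrite /= kK.
apply/setP => h; rewrite inE; apply/imsetP/andP => [[[g j] + ->] | [bh]].
  rewrite inE /= => /and3P[bg ltg /andP[lt_kj le_jg]].
  have gE : two_step_of (g, j) (inord k) = g ord_max.
    have lt_kk : (inord k : 'I_n.+1) < k.+1 by rewrite kK.
    by rewrite (extend_lt _ _ lt_kk); congr (g _); apply: val_inj.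
  split.
    apply: ballot_extend => //= [i i' _ le_ii' _ | i i' _ _ | i le_ki lt_in].
    - case: (ltnP i' j) => [lt_i'j | _]; first by rewrite (leq_ltn_trans le_ii').
      by rewrite -ltnS ltn_ord.
    - case: ifP => _; last by rewrite -ltnS ltn_ord.
      by have [mono _] := ballotP _ bg; apply: mono; rewrite -ltnS.
    by case: ifP => // lt_ij; rewrite -ltnS (leq_trans lt_ij).
  rewrite /two_step gE ltg /=; apply/existsP; exists j.
  rewrite lt_kj extend_ge //= ltnn eqxx /=; apply/forallP => i; apply/implyP.
  move=> /andP[]; rewrite leq_eqVlt => /orP[/eqP eki | lt_ki] lt_ij.
    by rewrite -gE; apply/eqP; congr (two_step_of _ _); apply: val_inj; rewrite /= kK.
  by rewrite extend_ge //= lt_ij.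
move=> /andP[ltHk /existsP[j /and3P[lt_kj /eqP hj /forallP flat]]].
have [mono diag] := ballotP _ bh.
exists (initial (leqW lt_kn) h, j).
  rewrite inE /= ballot_initial //= ffunE widen_max ltHk lt_kj /=.
  (* The diagonal condition at [j.-1], where [h] still has its value at [k],
     bounds the place of the jump. *)
  have lt_j : j.-1 < n.+1 by rewrite (leq_ltn_trans (leq_pred _)).
  have := flat (Ordinal lt_j); rewrite -ltnS /= (ltn_predK lt_kj) lt_kj leqnn.
  by move=> /eqP <-; have := diag (Ordinal lt_j); rewrite /= -ltnS (ltn_predK lt_kj).
apply/ffunP => i; have [lt_ki | le_ik] := ltnP k i; last first.
  by rewrite extend_lt // ffunE; congr (h _); exact: val_inj.
rewrite extend_ge //=; case: ltnP => [lt_ij | le_ji].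
  by have := flat i; rewrite (ltnW lt_ki) lt_ij ffunE widen_max /= => /eqP.
apply/val_inj/eqP; rewrite eqn_leq -ltnS ltn_ord /=.
by rewrite -[leqLHS]hj; exact: mono.
Qed.

(** For a given threshold [v], the initial segment and the place of the jump,
    one of [k.+1, ..., v.+1], are chosen independently. *)
Lemma card_two_step n k : k < n ->
  #|[set h : {ffun 'I_n.+1 -> 'I_n.+1} | ballot h && two_step k h]|
    = \sum_(k <= v < n) #|ballots_below n.+1 k v.+1| * (v.+1 - k).
Proof.
move=> lt_kn; rewrite -two_step_of_image // card_in_imset; last exact: two_step_of_inj.
pose last (d : {ffun 'I_k.+1 -> 'I_n.+1} * 'I_n.+1) := d.1 ord_max.
rewrite -sum1_card (partition_big last (fun v : 'I_n.+1 => k <= v < n)) /=; last first.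
  move=> d; rewrite inE => /and3P[/ballotP[_ diag] -> _]; rewrite andbT.
  exact: (diag ord_max).
rewrite (big_nat_widenl k 0) // (big_nat_widen 0 n n.+1) //= big_mkord.
apply: eq_big => [v | v /andP[le_kv lt_vn]]; first by [].
rewrite sum1dep_card -card_ballot_last // -[v.+1 - k]subSS -(@card_interval n.+1 k.+1 v.+2) //.
rewrite -cardsX; apply: eq_card => -[g j]; rewrite !inE /= /last /=.
case: eqVneq => [-> | _]; last by rewrite !andbF.
by rewrite lt_vn !andbT.
Qed.

(** * The probability *)

Local Close Scope nat_scope.

Lemma card_avoids321 N : #|[set p : 'S_N | avoids321 p]|%:R = catalan N :> rat.
Proof.
have -> : (#|[set p : 'S_N | avoids321 p]| = #|ballots_below N N N|)%N.
  transitivity #|[set p : 'S_N | avoids321 p && true]|%N.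
    by apply: eq_card => p; rewrite !inE andbT.
  rewrite (@card_avoids321_runmax _ _ xpredT) //; apply: eq_card => h.
  by rewrite !inE andbT; case: ballot => //=; apply/esym/forallP.
have := card_ballots_below (leqnSn N) (leqnn N).
rewrite subSnn muln1 addnn => /(congr1 (fun x => x%:R : rat)); rewrite natrM /catalan => <-.
by rewrite mulrC mulfK // pnatr_eq0.
Qed.

Lemma card_winnable N k : (1 <= k)%N -> (k <= N - 1)%N ->
  #|[set p : 'S_N | avoids321 p && winnable k p]|%:R
    = \sum_(1 <= i < (N - k).+1)
      ('C((k - 1) + (N - i), k - 1)%:R
       * ((N - k - i + 2)%N%:R / ((N - i) + 1)%N%:R)
       * (N - k - i + 1)%N%:R) :> rat.
Proof.
case: N => [|n]; first by case: k.
case: k => // k _; rewrite !subn1 /= => lt_kn.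
rewrite (card_avoids321_runmax (fun p => winnable_two_step p lt_kn)) card_two_step //.
(* The summation index of the theorem is the distance from the top value to the
   threshold, whence the reversal of the sum. *)
rewrite natr_sum subSS big_nat_rev /= -{1}[k]add0n big_addn.
rewrite big_add1 /=.
apply: eq_big_nat => i /andP[_ lt_in].
have -> : ((k + n - (i + k).+1).+1 = n - i)%N by lia.
have -> : (n - k - i.+1 + 2 = (n - i).+1 - k)%N by lia.
have -> : (n - k - i.+1 + 1 = n - i - k)%N by lia.
rewrite subSS addn1 natrM; congr (_ * _).
have le_kM : (k <= (n - i).+1)%N by lia.
have le_Mn : (n - i <= n.+1)%N by lia.
have := card_ballots_below le_kM le_Mn => /(congr1 (fun x => x%:R : rat)).
by rewrite !natrM mulrA => <-; rewrite mulfK // pnatr_eq0.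
Qed.

Theorem theorem4p11 (N k : nat) (hN : (2 <= N)%N) (hk1 : (1 <= k)%N)
    (hkN : (k <= N - 1)%N) :
  uniform_prob (@avoids321 N) (@winnable N k) =
  (catalan N)^-1 *
    \sum_(1 <= i < (N - k).+1)
      ('C((k - 1) + (N - i), k - 1)%:R
       * ((N - k - i + 2)%N%:R / ((N - i) + 1)%N%:R)
       * (N - k - i + 1)%N%:R).
Proof.
by rewrite /uniform_prob card_avoids321 card_winnable // mulrC.
Qed.
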